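(* Let $h:\mathbb{R}^d\times\mathbb{R}^d\to\mathbb{R}^p$ be an anti-symmetric function, i.e. $h(v,v')=-h(v',v)$ for all $v,v'$. Suppose that $\Pr\bigl(W_i=1\mid A_i(0),A_i(1),Y_i(A_i(0)),Y_i(A_i(1)),X_i\bigr)=1/2$. Then the conditional treatment-averaged causal effect $\tau_h(\delta)=\mathbb{E}[\tau_i\mid h(V_i,V_i^N)=\delta]$ is identified, since it can be expressed in terms of the joint distribution of the observed $(Y_i,V_i,V_i^N,X_i)$ as $$\tau_h(\delta)=\mathbb{E}[Y_i\mid h(V_i,V_i^N)=\delta]-\mathbb{E}[Y_i\mid h(V_i,V_i^N)=-\delta].$$
   Context: Setting (one generic unit $i$; all objects are random elements on a common probability space, all functions are measurable). $\mathcal{A}$ is a set of treatments; $Y_i(a)\in\mathbb{R}$ is the potential outcome of unit $i$ under treatment $a\in\mathcal{A}$. The unit has a random pair of potential treatments $A_i(0),A_i(1)\in\mathcal{A}$, characteristics $X_i$, and an assignment indicator $W_i\in\{0,1\}$. The realized and non-realized treatments are $A_i=A_i(W_i)$ and $A_i^N=A_i(1-W_i)$; the realized and non-realized outcomes are $Y_i=Y_i(A_i(W_i))$ and $Y_i^N=Y_i(A_i(1-W_i))$. A feature map $f:\mathcal{A}\to\mathbb{R}^d$ gives $V_i=f(A_i)$, $V_i^N=f(A_i^N)$, and $V_i(w)=f(A_i(w))$ for $w\in\{0,1\}$. The unit-level causal effect of the treatment received is $\tau_i=Y_i-Y_i^N$. Outcomes $Y_i(A_i(0)),Y_i(A_i(1))$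 are integrable. Convention: conditional expectations given $h(V_i,V_i^N)=\delta$ are elementary ones when this event has positive probability, and otherwise versions of the regression function given $h(V_i,V_i^N)$, with the equality holding for almost every $\delta$ with respect to the law of $h(V_i,V_i^N)$. *)

(* Defs.v *)
From HB Require Import structures.
From mathcomp Require Import all_boot all_order all_algebra.
From mathcomp Require Import all_classical all_reals all_analysis.
From mathcomp Require Import measurable_realfun.

Set Implicit Arguments.
Unset Strict Implicit.
Unset Printing Implicit Defensive.

Import Order.TTheory GRing.Theory Num.Theory.
Import numFieldNormedType.Exports.

Local Open Scope classical_set_scope.
Local Open Scope ring_scope.

Definition measure_rV_display : measure_display -> measure_display.
Proof. exact. Qed.

(* Row vectors carry the product sigma-algebra, generated by the coordinate
   maps; for entries in a [realType] it is the Borel sigma-algebra of R^n. *)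
Section measurable_rV.
Context {d} {T : measurableType d}.
Variable n : nat.

Let coord : 'I_n -> 'rV[T]_n -> T := fun i v => v ord0 i.

Let rV_set0 : g_sigma_preimage coord set0.
Proof. exact: sigma_algebra0. Qed.

Let rV_setC A : g_sigma_preimage coord A -> g_sigma_preimage coord (~` A).
Proof. exact: sigma_algebraC. Qed.

Let rV_bigcup (F : (set 'rV[T]_n)^nat) :
  (forall i, g_sigma_preimage coord (F i)) ->
  g_sigma_preimage coord (\bigcup_i F i).
Proof. exact: sigma_algebra_bigcup. Qed.

HB.instance Definition _ := @isMeasurable.Build (measure_rV_display d)
  'rV[T]_n (g_sigma_preimage coord) rV_set0 rV_setC rV_bigcup.

End measurable_rV.

Section conditioning.
Context d (T : measurableType d) (R : realType) (P : probability T R).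

Definition cond_mean (Z : T -> R) (E : set T) : R :=
  (\int[P]_(w in E) Z w) / fine (P E).

(* [g] is a version of the regression function s |-> E[Z | H = s]; that is,
   [g \o H] is a version of E[Z | sigma(H)]. *)
Definition regression_function d' (S : measurableType d') (Z : T -> R)
    (H : {RV P >-> S}) (g : S -> R) : Prop :=
  (distribution P H).-integrable [set: S] (EFin \o g) /\
  forall B : set S, measurable B ->
    (\int[P]_(w in H @^-1` B) (Z w)%:E =
     \int[distribution P H]_(s in B) (g s)%:E)%E.

Definition cond_probability d' (S : measurableType d') (E : set T)
    (H : {RV P >-> S}) (g : S -> R) : Prop :=
  regression_function \1_E H g.

End conditioning.

Arguments regression_function {d T R} P {d' S} Z H g.
Arguments cond_probability {d T R} P {d' S} E H g.

(* [potential_treatment M w] is A_i(w) and [potential_outcome M a] is Y_i(a),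
   the values 0 and 1 of w and of the assignment indicator being encoded by
   [false] and [true].  Joint measurability of (a, o) |-> Y_i(a)(o) is not
   required: integrability of Y_i(A_i(w)) includes its measurability. *)
Record unit_model (R : realType) dA (A : measurableType dA)
    dX (X : measurableType dX) := UnitModel {
  sample_display : measure_display;
  sample : measurableType sample_display;
  prob : probability sample R;
  potential_outcome : A -> {RV prob >-> R};
  potential_treatment : bool -> {RV prob >-> A};
  characteristics : {RV prob >-> X};
  assignment : {RV prob >-> bool};
  integrable_outcome : forall w : bool,
    prob.-integrable [set: sample]
      (EFin \o (fun o => potential_outcome (potential_treatment w o) o))
}.

Section unit.
Context {R : realType} {dA} {A : measurableType dA}
  {dX} {X : measurableType dX}.
Variable M : unit_model R A X.

Local Notation T := (sample M).
Local Notation W := (assignment M).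

Definition outcome (w : bool) (o : T) : R :=
  potential_outcome M (potential_treatment M w o) o.

Definition realized_treatment (o : T) : A := potential_treatment M (W o) o.

Definition nonrealized_treatment (o : T) : A :=
  potential_treatment M (~~ W o) o.

Definition realized_outcome (o : T) : R :=
  potential_outcome M (realized_treatment o) o.

Definition nonrealized_outcome (o : T) : R :=
  potential_outcome M (nonrealized_treatment o) o.

Definition unit_effect (o : T) : R :=
  realized_outcome o - nonrealized_outcome o.

Lemma measurable_outcome w : measurable_fun [set: T] (outcome w).
Proof.
have /integrableP[mf _] := integrable_outcome M w.
exact/measurable_EFinP.
Qed.

Lemma measurable_assigned d' (S : measurableType d') (F : bool -> T -> S)
    (k : bool -> bool) :
  (forall w, measurable_fun [set: T] (F w)) ->
  measurable_fun [set: T] (fun o => F (k (W o)) o).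
Proof.
move=> mF; rewrite (_ : (fun _ => _) =
  (fun o => if W o then F (k true) o else F (k false) o)); last first.
  by apply/funext => o; case: (W o).
by apply: measurable_fun_ifT => //; exact: measurable_funPT.
Qed.

Lemma measurable_realized_treatment :
  measurable_fun [set: T] realized_treatment.
Proof.
apply: (@measurable_assigned _ _ (fun w => potential_treatment M w) id) => w.
exact: measurable_funPT.
Qed.

Lemma measurable_nonrealized_treatment :
  measurable_fun [set: T] nonrealized_treatment.
Proof.
apply: (@measurable_assigned _ _ (fun w => potential_treatment M w) negb) => w.
exact: measurable_funPT.
Qed.

Lemma measurable_realized_outcome : measurable_fun [set: T] realized_outcome.
Proof.
exact: (@measurable_assigned _ _ outcome id measurable_outcome).
Qed.

(* The conditioning vector (A_i(0), A_i(1), Y_i(A_i(0)), Y_i(A_i(1)), X_i). *)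
Definition potentials (o : T) : A * A * R * R * X :=
  (potential_treatment M false o, potential_treatment M true o,
   outcome false o, outcome true o, characteristics M o).

Lemma measurable_potentials : measurable_fun [set: T] potentials.
Proof.
by repeat apply: measurable_fun_pair;
  first [exact: measurable_outcome | exact: measurable_funPT].
Qed.

HB.instance Definition _ :=
  isMeasurableFun.Build _ _ _ _ potentials measurable_potentials.

Definition fair_assignment : Prop :=
  cond_probability (prob M) [set o | W o = true] potentials (cst 2^-1).

Section feature.
Context {n : nat}.
Variable f : {mfun A >-> 'rV[R]_n}.

Definition features (o : T) : 'rV[R]_n * 'rV[R]_n :=
  (f (realized_treatment o), f (nonrealized_treatment o)).

Lemma measurable_features : measurable_fun [set: T] features.
Proof.
apply: measurable_fun_pair.
- exact: measurableT_comp measurable_realized_treatment.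
- exact: measurableT_comp measurable_nonrealized_treatment.
Qed.

HB.instance Definition _ :=
  isMeasurableFun.Build _ _ _ _ features measurable_features.

(* The observed vector (Y_i, (V_i, V_i^N), X_i). *)
Definition observed (o : T) : R * ('rV[R]_n * 'rV[R]_n) * X :=
  (realized_outcome o, features o, characteristics M o).

Lemma measurable_observed : measurable_fun [set: T] observed.
Proof.
apply: measurable_fun_pair; last exact: measurable_funPT.
apply: measurable_fun_pair; first exact: measurable_realized_outcome.
exact: measurable_features.
Qed.

HB.instance Definition _ :=
  isMeasurableFun.Build _ _ _ _ observed measurable_observed.

Definition observed_law : probability (R * ('rV[R]_n * 'rV[R]_n) * X)%type R :=
  distribution (prob M) observed.

Section contrast.
Context {p : nat}.
Variable h : {mfun ('rV[R]_n * 'rV[R]_n)%type >-> 'rV[R]_p}.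

Definition contrast (o : T) : 'rV[R]_p := h (features o).

Lemma measurable_contrast : measurable_fun [set: T] contrast.
Proof. exact: measurableT_comp measurable_features. Qed.

HB.instance Definition _ :=
  isMeasurableFun.Build _ _ _ _ contrast measurable_contrast.

Definition contrast_law : probability 'rV[R]_p R :=
  distribution (prob M) contrast.

Definition contrast_event (delta : 'rV[R]_p) : set T :=
  [set o | contrast o = delta].

End contrast.
End feature.
End unit.

Arguments realized_outcome {R dA A dX X} M o.
Arguments nonrealized_outcome {R dA A dX X} M o.
Arguments unit_effect {R dA A dX X} M o.
Arguments observed {R dA A dX X} M {n} f o.
Arguments contrast {R dA A dX X} M {n} f {p} h o.
Arguments contrast_law {R dA A dX X} M {n} f {p} h.
Arguments contrast_event {R dA A dX X} M {n} f {p} h delta.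

(* Within the class of models with fair assignment, the law of the observed
   vector determines tau_h, up to almost everywhere equality of versions. *)
Definition tau_h_identified (R : realType) dA (A : measurableType dA)
    dX (X : measurableType dX) (M : unit_model R A X) (n p : nat)
    (f : {mfun A >-> 'rV[R]_n})
    (h : {mfun ('rV[R]_n * 'rV[R]_n)%type >-> 'rV[R]_p}) : Prop :=
  forall M' : unit_model R A X, fair_assignment M' ->
    (forall B, measurable B -> observed_law M' f B = observed_law M f B) ->
    (forall delta, (0 < prob M (contrast_event M f h delta))%E ->
       (0 < prob M' (contrast_event M' f h delta))%E /\
       cond_mean (prob M') (unit_effect M') (contrast_event M' f h delta) =
       cond_mean (prob M) (unit_effect M) (contrast_event M f h delta)) /\
    (forall tau tau' : 'rV[R]_p -> R,
       regression_function (prob M) (unit_effect M) (contrast M f h) tau ->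
       regression_function (prob M') (unit_effect M') (contrast M' f h) tau' ->
       {ae contrast_law M f h, forall delta, tau' delta = tau delta}).

(* Main.v *)
(* Fairness given the potentials makes the law of (potentials, W) invariant
   under W |-> 1 - W.  This flip exchanges Y with Y^N and, h being
   antisymmetric, changes the sign of C = h(V, V^N); so (Y^N, C) and (Y, -C)
   have the same law, and the mean of Y^N on {C in B} is that of Y on
   {-C in B}. *)
Require Import Defs.
From mathcomp Require Import all_boot all_order all_algebra.
From mathcomp Require Import all_classical all_reals all_analysis.
From mathcomp Require Import measurable_realfun.

Import Order.TTheory GRing.Theory Num.Theory.

Local Open Scope classical_set_scope.
Local Open Scope ring_scope.

(** * Measurability in the space of row vectors, and integrals under equal laws *)

Lemma measurable_rV_coord {d} {T : measurableType d} {n : nat} (i : 'I_n) :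
  measurable_fun [set: 'rV[T]_n] (fun v : 'rV[T]_n => v ord0 i).
Proof.
move=> _ Y mY; rewrite setTI; apply: sub_sigma_algebra => /=.
rewrite -bigcup_seq/=; exists i => /=; first by rewrite mem_index_enum.
by exists Y => //; rewrite setTI.
Qed.

Lemma measurable_fun_rV {d d'} {S : measurableType d} {T : measurableType d'}
    {n : nat} (F : S -> 'rV[T]_n) :
  (forall i, measurable_fun [set: S] (fun x => F x ord0 i)) ->
  measurable_fun [set: S] F.
Proof.
move=> mF; apply: measurability; first by [].
move=> _ [C + <-]; rewrite -bigcup_seq => -[i /= _ [Y mY <-]].
by rewrite [X in F @^-1` X]setTI; exact: mF.
Qed.

Lemma measurable_oppmx {R : realType} {n : nat} :
  measurable_fun [set: 'rV[R]_n] (fun v : 'rV[R]_n => - v).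
Proof.
apply: measurable_fun_rV => i; under eq_fun do rewrite mxE.
by apply: measurableT_comp; last exact: measurable_rV_coord.
Qed.

(** A point is a finite intersection of coordinate hyperplanes. This allows identities proved for
    every measurable [B] to be specialised to an atom [[set delta]]. *)
Lemma measurable_rV_set1 {R : realType} {n : nat} (v : 'rV[R]_n) :
  measurable [set v].
Proof.
rewrite (_ : [set v] =
    \bigcap_(i : 'I_n) [set u : 'rV[R]_n | u ord0 i = v ord0 i]).
  apply: fin_bigcap_measurable => // i _; rewrite -[X in measurable X]setTI.
  exact: (measurable_rV_coord i measurableT _ (measurable_set1 (v ord0 i))).
apply/seteqP; split => [_ -> //|u uv]; apply/rowP => i; exact: uv.
Qed.

Lemma measurable_preimage {d d'} {S : measurableType d} {T : measurableType d'}
    {F : S -> T} (B : set T) :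
  measurable_fun [set: S] F -> measurable B -> measurable (F @^-1` B).
Proof. by move=> mF mB; rewrite -[X in measurable X]setTI; exact: mF. Qed.

(** Both sides become integrals of [g] over [D] against image measures on [S], and these agree on
    measurable sets. The two source spaces may differ, so that the lemma serves both inside one
    model and between two models. *)
Lemma eq_law_integral {d1 d2 d} {T1 : measurableType d1}
    {T2 : measurableType d2} {S : measurableType d} {R : realType}
    (mu1 : {measure set T1 -> \bar R}) (mu2 : {measure set T2 -> \bar R})
    (phi1 : T1 -> S) (phi2 : T2 -> S) (g : S -> R) (D : set S) :
  measurable_fun [set: T1] phi1 -> measurable_fun [set: T2] phi2 ->
  (forall B, measurable B -> mu1 (phi1 @^-1` B) = mu2 (phi2 @^-1` B)) ->
  measurable_fun [set: S] g -> measurable D ->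
  mu1.-integrable [set: T1] (fun x => (g (phi1 x))%:E) ->
  mu2.-integrable [set: T2] (fun x => (g (phi2 x))%:E) ->
  (\int[mu1]_(x in phi1 @^-1` D) (g (phi1 x))%:E =
   \int[mu2]_(x in phi2 @^-1` D) (g (phi2 x))%:E)%E.
Proof.
move=> m1 m2 law mg mD i1 i2.
have mD1 : measurable (phi1 @^-1` D) by exact: measurable_preimage.
have mD2 : measurable (phi2 @^-1` D) by exact: measurable_preimage.
have mgE : measurable_fun [set: S] (EFin \o g) by exact/measurable_EFinP.
have j1 : mu1.-integrable (phi1 @^-1` D) (EFin \o g \o phi1).
  by exact: integrableS i1.
have j2 : mu2.-integrable (phi2 @^-1` D) (EFin \o g \o phi2).
  by exact: integrableS i2.
rewrite -[LHS](integral_pushforward m1 mgE j1 mD).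
rewrite -[RHS](integral_pushforward m2 mgE j2 mD).
by apply: eq_measure_integral => B mB _; exact: law.
Qed.

(** * One model: integrability of the outcomes and the fair coin *)

Section unit.
Context {R : realType} {dA} {A : measurableType dA}
  {dX} {X : measurableType dX}.
Variable M : unit_model R A X.
Local Notation T := (sample M).
Local Notation P := (prob M).
Local Notation W := (assignment M).
Local Notation outcome := (@outcome R dA A dX X M).
Local Notation potentials := (@potentials R dA A dX X M).

Lemma measurable_assignment (b : bool) : measurable [set o | W o = b].
Proof.
rewrite -[X in measurable X]setTI.
have mW : measurable_fun [set: T] W by exact: measurable_funPT.
exact: (mW measurableT [set b]).
Qed.

(** Whichever arm [k] selects, the outcome is dominated by the sum of the absolute values of the two
    potential outcomes. The choices [id] and [negb] give the realized and the non-realized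
    outcome. *)
Lemma integrable_assigned_outcome (k : bool -> bool) :
  P.-integrable [set: T] (fun o => (outcome (k (W o)) o)%:E).
Proof.
have iabs w : P.-integrable [set: T] (fun o => `|outcome w o|%:E).
  exact: (integrable_abse (integrable_outcome M w)).
apply: (@le_integrable _ _ _ _ _ _ _
  (fun o => `|outcome false o|%:E + `|outcome true o|%:E)%E) => //.
- apply/measurable_EFinP.
  exact: (@measurable_assigned _ _ _ _ _ M _ _ outcome k
    (@measurable_outcome _ _ _ _ _ M)).
- move=> o _; rewrite -EFinD !abse_EFin lee_fin [leRHS]ger0_norm ?addr_ge0//.
  by case: (k _); rewrite (lerDl, lerDr).
- exact: integrableD.
Qed.

Lemma integrable_realized_outcome :
  P.-integrable [set: T] (EFin \o realized_outcome M).
Proof. exact: (integrable_assigned_outcome id). Qed.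

Lemma integrable_nonrealized_outcome :
  P.-integrable [set: T] (EFin \o nonrealized_outcome M).
Proof. exact: (integrable_assigned_outcome negb). Qed.

(** For [true] this is the defining property of the version [cst 2^-1], integrated over [B]; for
    [false] it follows by complement, the remaining mass being also one half. *)
Lemma fair_assignment_half (b : bool) (B : set (A * A * R * R * X)) :
  fair_assignment M -> measurable B ->
  P (potentials @^-1` B `&` [set o | W o = b]) =
  ((2^-1)%:E * P (potentials @^-1` B))%E.
Proof.
move=> M_fair mB.
have mE : measurable (potentials @^-1` B).
  by apply: measurable_preimage => //; exact: measurable_potentials.
have half : P (potentials @^-1` B `&` [set o | W o = true]) =
    ((2^-1)%:E * P (potentials @^-1` B))%E.
  have [_ /(_ _ mB)] := M_fair.
  rewrite integral_indic//; last exact: measurable_assignment.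
  by rewrite setIC => ->;
    exact: (integral_cst (distribution P potentials) mB (2^-1)%:E).
case: b => //.
have -> : potentials @^-1` B `&` [set o | W o = false] =
    potentials @^-1` B `\` (potentials @^-1` B `&` [set o | W o = true]).
  apply/seteqP; split => o /=; first by case=> ? ->; split => // -[].
  by case=> Bo nW; split => //; apply/negbTE/negP => Wo; exact: nW.
rewrite measureD//; last 2 first.
- by apply: measurableI => //; exact: measurable_assignment.
- by rewrite -ge0_fin_numE// fin_num_measure.
rewrite setIA setIid [X in (_ - X)%E]half.
rewrite -[P (_ @^-1` B)](fineK (fin_num_measure P _ mE)).
rewrite -[X in (X - _)%E](fineK (fin_num_measure P _ mE)).
rewrite -EFinM -EFinB; congr EFin.
by rewrite {1}[fine _]splitr mulrC addrK.
Qed.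

(** * One model: flip symmetry and the formula for the effect *)

Section contrast.
Context {n p : nat}.
Variable f : {mfun A >-> 'rV[R]_n}.
Variable h : {mfun ('rV[R]_n * 'rV[R]_n)%type >-> 'rV[R]_p}.
Hypothesis h_antisym : forall v v' : 'rV[R]_n, h (v, v') = - h (v', v).
Hypothesis M_fair : fair_assignment M.
Local Notation C := (contrast M f h).

Lemma measurable_contrast_preimage (B : set 'rV[R]_p) :
  measurable B -> measurable (C @^-1` B).
Proof.
exact: measurable_preimage (@measurable_contrast _ _ _ _ _ M _ f _ h).
Qed.

Lemma measurable_oppr_contrast : measurable_fun [set: T] (fun o => - C o).
Proof.
exact: (measurableT_comp measurable_oppmx
  (@measurable_contrast _ _ _ _ _ M _ f _ h)).
Qed.

Lemma measurable_oppr_contrast_preimage (B : set 'rV[R]_p) :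
  measurable B -> measurable ((fun o => - C o) @^-1` B).
Proof. exact: measurable_preimage measurable_oppr_contrast. Qed.

Lemma nonrealized_outcome_contrast_law (D : set (R * 'rV[R]_p)) :
  measurable D ->
  P ((fun o => (nonrealized_outcome M o, C o)) @^-1` D) =
  P ((fun o => (realized_outcome M o, - C o)) @^-1` D).
Proof.
move=> mD.
pose S := (A * A * R * R * X)%type.
(* As functions of the potentials, [g0] and [g1] are the values of (Y^N, C) on W = 1 and on W = 0.
   By antisymmetry they are also the values of (Y, -C) on W = 0 and on W = 1. *)
pose g0 (t : S) := (t.1.1.2, h (f t.1.1.1.2, f t.1.1.1.1)).
pose g1 (t : S) := (t.1.2, h (f t.1.1.1.1, f t.1.1.1.2)).
have m1 : measurable_fun [set: S] (fun t => t.1) by exact: measurable_fst.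
have m11 : measurable_fun [set: S] (fun t => t.1.1).
  exact: (measurableT_comp measurable_fst m1).
have m111 : measurable_fun [set: S] (fun t => t.1.1.1).
  exact: (measurableT_comp measurable_fst m11).
have mA0 : measurable_fun [set: S] (fun t => f t.1.1.1.1).
  exact: (measurableT_comp (measurable_funPT f)
    (measurableT_comp measurable_fst m111)).
have mA1 : measurable_fun [set: S] (fun t => f t.1.1.1.2).
  exact: (measurableT_comp (measurable_funPT f)
    (measurableT_comp measurable_snd m111)).
have mg0 : measurable_fun [set: S] g0.
  apply: measurable_fun_pair.
    exact: (measurableT_comp measurable_snd m11).
  exact: (measurableT_comp (measurable_funPT h) (measurable_fun_pair mA1 mA0)).
have mg1 : measurable_fun [set: S] g1.
  apply: measurable_fun_pair.
    exact: (measurableT_comp measurable_snd m1).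
  exact: (measurableT_comp (measurable_funPT h) (measurable_fun_pair mA0 mA1)).
have mD0 : measurable (g0 @^-1` D) by exact: measurable_preimage.
have mD1 : measurable (g1 @^-1` D) by exact: measurable_preimage.
have mpot B : measurable B -> measurable (potentials @^-1` B).
  by move=> mB; apply: measurable_preimage => //; exact: measurable_potentials.
(* The right-hand side does not depend on [b]: this is the invariance under exchanging the arms. *)
have split b E0 E1 : measurable E0 -> measurable E1 ->
    P ((potentials @^-1` E0 `&` [set o | W o = b]) `|`
       (potentials @^-1` E1 `&` [set o | W o = ~~ b])) =
    ((2^-1)%:E * P (potentials @^-1` E0) +
     (2^-1)%:E * P (potentials @^-1` E1))%E.
  move=> mE0 mE1; rewrite measureU//.
  - by congr (_ + _)%E; exact: fair_assignment_half.
  - by apply: measurableI; [exact: mpot|exact: measurable_assignment].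
  - by apply: measurableI; [exact: mpot|exact: measurable_assignment].
  - by apply/seteqP; split => // o /= [[_ ->] [_]]; case: b.
transitivity (P ((potentials @^-1` (g0 @^-1` D) `&` [set o | W o = true]) `|`
    (potentials @^-1` (g1 @^-1` D) `&` [set o | W o = ~~ true]))).
  congr (P _); apply/seteqP; split => o /=;
    rewrite /g0 /g1 /nonrealized_outcome /nonrealized_treatment /contrast
      /features /realized_treatment /nonrealized_treatment /= /outcome.
  - by case: (W o) => /= ?; [left|right].
  - by case=> -[+ ->].
transitivity (P ((potentials @^-1` (g0 @^-1` D) `&` [set o | W o = false]) `|`
    (potentials @^-1` (g1 @^-1` D) `&` [set o | W o = ~~ false]))).
  by rewrite !split.
congr (P _); apply/seteqP; split => o /=;
  rewrite /g0 /g1 /realized_outcome /contrast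
    /features /realized_treatment /nonrealized_treatment /= /outcome -h_antisym.
- by case=> -[+ ->].
- by case: (W o) => /= ?; [right|left].
Qed.

Lemma contrast_symmetric (B : set 'rV[R]_p) : measurable B ->
  P ((fun o => - C o) @^-1` B) = P (C @^-1` B).
Proof.
move=> mB.
have := nonrealized_outcome_contrast_law ([set: R] `*` B)
  (measurableX measurableT mB).
have setTXE (Z : T -> R) (G : T -> 'rV[R]_p) :
    (fun o => (Z o, G o)) @^-1` ([set: R] `*` B) = G @^-1` B.
  by apply/seteqP; split => o //= [].
by rewrite !setTXE.
Qed.

Lemma integral_nonrealized_outcome (B : set 'rV[R]_p) : measurable B ->
  (\int[P]_(o in C @^-1` B) (nonrealized_outcome M o)%:E =
   \int[P]_(o in (fun o => (- C o)%R) @^-1` B) (realized_outcome M o)%:E)%E.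
Proof.
move=> mB.
have setTXE (Z : T -> R) (G : T -> 'rV[R]_p) :
    G @^-1` B = (fun o => (Z o, G o)) @^-1` ([set: R] `*` B).
  by apply/seteqP; split => o //= [].
rewrite (setTXE (nonrealized_outcome M)) (setTXE (realized_outcome M)).
apply: (eq_law_integral _ _ _ _ fst).
- apply: measurable_fun_pair; last exact: measurable_contrast.
  by apply/measurable_EFinP/(measurable_int _ integrable_nonrealized_outcome).
- apply: measurable_fun_pair; last exact: measurable_oppr_contrast.
  exact: measurable_realized_outcome.
- exact: nonrealized_outcome_contrast_law.
- by [].
- exact: measurableX.
- exact: integrable_nonrealized_outcome.
- exact: integrable_realized_outcome.
Qed.

(** The integrated form of the formula, from which both versions follow: singletons [B] give the
    elementary conditional means, and arbitrary [B] the regression functions. *)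
Lemma integral_unit_effect (B : set 'rV[R]_p) : measurable B ->
  (\int[P]_(o in C @^-1` B) (unit_effect M o)%:E =
   \int[P]_(o in C @^-1` B) (realized_outcome M o)%:E -
   \int[P]_(o in (fun o => (- C o)%R) @^-1` B) (realized_outcome M o)%:E)%E.
Proof.
move=> mB; have mCB := measurable_contrast_preimage B mB.
rewrite -integral_nonrealized_outcome//.
under eq_integral do rewrite EFinB.
rewrite integralB_EFin//.
- exact: integrableS integrable_realized_outcome.
- exact: integrableS integrable_nonrealized_outcome.
Qed.

Lemma oppr_contrast_event (delta : 'rV[R]_p) :
  (fun o => - C o) @^-1` [set delta] = contrast_event M f h (- delta).
Proof.
by apply/seteqP; split => o /= ; [move=> <-|move=> ->]; rewrite /= opprK.
Qed.

Lemma contrast_event_oppr (delta : 'rV[R]_p) :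
  P (contrast_event M f h (- delta)) = P (contrast_event M f h delta).
Proof.
by rewrite -oppr_contrast_event contrast_symmetric//; exact: measurable_rV_set1.
Qed.

Lemma cond_mean_unit_effect (delta : 'rV[R]_p) :
  cond_mean P (unit_effect M) (contrast_event M f h delta) =
  cond_mean P (realized_outcome M) (contrast_event M f h delta)
  - cond_mean P (realized_outcome M) (contrast_event M f h (- delta)).
Proof.
have md := measurable_rV_set1 delta.
(* The events at [delta] and [- delta] have the same probability, so the two quotients share their
   denominator and only the integrals remain to be compared. *)
rewrite /cond_mean contrast_event_oppr -mulrBl; congr (_ / _).
have fin E : measurable E ->
    (\int[P]_(o in E) (realized_outcome M o)%:E)%E \is a fin_num.
  move=> mE; apply: integrable_fin_num => //.
  exact: integrableS integrable_realized_outcome.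
rewrite /Rintegral -oppr_contrast_event -fineB.
- by congr fine; exact: integral_unit_effect md.
- exact/fin/(measurable_contrast_preimage _ md).
- exact/fin/(measurable_oppr_contrast_preimage _ md).
Qed.

(** Two functions with the same integral over every measurable set agree almost everywhere, so it
    suffices to integrate the formula over each [B]. *)
Lemma regression_unit_effect (tau m : 'rV[R]_p -> R) :
  regression_function P (unit_effect M) C tau ->
  regression_function P (realized_outcome M) C m ->
  {ae contrast_law M f h, forall delta, tau delta = m delta - m (- delta)}.
Proof.
move=> [itau Etau] [im Em].
pose opp (v : 'rV[R]_p) : 'rV[R]_p := - v.
have mm : measurable_fun [set: 'rV[R]_p] m.
  by have /integrableP[/measurable_EFinP] := im.
have law_opp B : measurable B ->
    contrast_law M f h (opp @^-1` B) = contrast_law M f h B.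
  exact: contrast_symmetric.
have mopp_pre B : measurable B -> measurable (opp @^-1` B).
  exact: measurable_preimage measurable_oppmx.
(* The substitution v |-> -v turns the integral of |m(-v)| into that of |m| against the reflected
   law, which is the law of C itself. *)
have imN : (contrast_law M f h).-integrable [set: 'rV[R]_p]
    (fun v => (m (- v))%:E).
  have mmN : measurable_fun [set: 'rV[R]_p] (fun v : 'rV[R]_p => m (- v)).
    exact: measurableT_comp measurable_oppmx.
  apply/integrableP; split; first exact/measurable_EFinP.
  have /integrableP[_] := im; apply: le_lt_trans.
  have mabs : measurable_fun [set: 'rV[R]_p] (fun v => `|(m v)%:E|%E).
    by apply: measurableT_comp => //; exact/measurable_EFinP.
  have := ge0_integral_pushforward measurable_oppmx (contrast_law M f h)
    measurableT mabs.
  rewrite preimage_setT => /(_ (fun _ _ => abse_ge0 _)) /= <-.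
  rewrite (eq_measure_integral (contrast_law M f h))// => [|mopp D mD _].
    exact: measurable_oppmx.
  exact: law_opp.
have : ae_eq (contrast_law M f h) [set: 'rV[R]_p] (EFin \o tau)
    (fun v => (m v - m (- v))%:E).
  apply: integral_ae_eq => //.
    apply/measurable_EFinP/measurable_funB => //.
    exact: measurableT_comp measurable_oppmx.
  move=> B _ mB; rewrite -Etau// integral_unit_effect//.
  under [RHS]eq_integral do rewrite EFinB.
  rewrite integralB_EFin//; last 2 first.
  - exact: integrableS im.
  - exact: integrableS imN.
  rewrite -Em//; congr (_ - _)%E.
  (* The event {-C in B} is {C in -B}, so the defining property of [m] applies with the set -B. *)
  transitivity (\int[contrast_law M f h]_(v in opp @^-1` B) (m v)%:E)%E.
    exact: Em _ (mopp_pre B mB).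
  have law_id D : measurable D ->
      contrast_law M f h (id @^-1` D) = contrast_law M f h (opp @^-1` D).
    by move=> mD; rewrite [RHS]law_opp.
  (* By symmetry of the law, [id] and [opp] have the same image measure; reflecting -B gives back
     [B] and turns m(v) into m(-v). *)
  have -> := eq_law_integral _ _ id opp m _ (@measurable_id _ _ _)
    measurable_oppmx law_id mm (mopp_pre B mB) im imN.
  by congr (integral _ _ _); apply/seteqP; split => v /=; rewrite /opp opprK.
by apply: filterS => v /(_ I) [].
Qed.

End contrast.
End unit.

(** * Two models with the same observed law: identification *)

Section same_observed_law.
Context {R : realType} {dA} {A : measurableType dA}
  {dX} {X : measurableType dX} {n p : nat}.
Variables M M' : unit_model R A X.
Variable f : {mfun A >-> 'rV[R]_n}.
Variable h : {mfun ('rV[R]_n * 'rV[R]_n)%type >-> 'rV[R]_p}.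
Hypothesis same_law :
  forall B, measurable B -> observed_law M' f B = observed_law M f B.

(** The contrast read off the observed vector; through it, equality of observed laws passes to the
    contrast and to the integrals of the realized outcome. *)
Let hC (t : R * ('rV[R]_n * 'rV[R]_n) * X) : 'rV[R]_p := h t.1.2.

Let measurable_hC : measurable_fun setT hC.
Proof.
exact: (measurableT_comp (measurable_funPT h)
  (measurableT_comp measurable_snd measurable_fst)).
Qed.

Let measurable_hC_preimage (B : set 'rV[R]_p) :
  measurable B -> measurable (hC @^-1` B).
Proof. exact: measurable_preimage measurable_hC. Qed.

Lemma same_contrast_law (B : set 'rV[R]_p) :
  measurable B -> contrast_law M' f h B = contrast_law M f h B.
Proof. by move=> mB; exact: same_law (measurable_hC_preimage _ mB). Qed.

Lemma same_integral_realized_outcome (B : set 'rV[R]_p) : measurable B ->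
  (\int[prob M']_(o in contrast M' f h @^-1` B) (realized_outcome M' o)%:E =
   \int[prob M]_(o in contrast M f h @^-1` B) (realized_outcome M o)%:E)%E.
Proof.
move=> mB.
have mY : measurable_fun [set: R * ('rV[R]_n * 'rV[R]_n) * X] (fun t => t.1.1).
  exact: (measurableT_comp measurable_fst measurable_fst).
exact: (eq_law_integral _ _ _ _ _ (hC @^-1` B)
  (@measurable_observed _ _ _ _ _ M' _ f)
  (@measurable_observed _ _ _ _ _ M _ f) same_law mY
  (measurable_hC_preimage _ mB) (integrable_realized_outcome M')
  (integrable_realized_outcome M)).
Qed.

Lemma same_cond_mean_realized_outcome (delta : 'rV[R]_p) :
  cond_mean (prob M') (realized_outcome M') (contrast_event M' f h delta) =
  cond_mean (prob M) (realized_outcome M) (contrast_event M f h delta).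
Proof.
have md := measurable_rV_set1 delta.
have EP : prob M' (contrast_event M' f h delta) =
    prob M (contrast_event M f h delta).
  exact: same_contrast_law md.
by rewrite /cond_mean EP; congr (fine _ / _);
  exact: same_integral_realized_outcome md.
Qed.

Hypothesis h_antisym : forall v v' : 'rV[R]_n, h (v, v') = - h (v', v).
Hypothesis M_fair : fair_assignment M.
Hypothesis M'_fair : fair_assignment M'.

(** The effect involves the unobserved Y^N, so the laws cannot be compared directly. Fairness of
    both models first rewrites each side in terms of realized outcomes. *)
Lemma same_integral_unit_effect (B : set 'rV[R]_p) : measurable B ->
  (\int[prob M']_(o in contrast M' f h @^-1` B) (unit_effect M' o)%:E =
   \int[prob M]_(o in contrast M f h @^-1` B) (unit_effect M o)%:E)%E.
Proof.
move=> mB; rewrite !integral_unit_effect// same_integral_realized_outcome//.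
(* {-C in B} is {C in -B}, again an event of the form covered by the comparison. *)
congr (_ - _)%E; apply: same_integral_realized_outcome (-%R @^-1` B) _.
exact: measurable_preimage measurable_oppmx mB.
Qed.

Lemma same_regression_unit_effect (tau tau' : 'rV[R]_p -> R) :
  regression_function (prob M) (unit_effect M) (contrast M f h) tau ->
  regression_function (prob M') (unit_effect M') (contrast M' f h) tau' ->
  {ae contrast_law M f h, forall delta, tau' delta = tau delta}.
Proof.
move=> [itau Etau] [/integrableP[mtau' _] Etau'].
have : ae_eq (contrast_law M f h) [set: 'rV[R]_p] (EFin \o tau) (EFin \o tau').
  (* Both versions have the same integrals against the common law of the contrast, hence they agree
     almost everywhere. *)
  apply: integral_ae_eq => // B _ mB.
  rewrite -Etau// -same_integral_unit_effect// Etau'//.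
  by apply: eq_measure_integral => D mD _; exact: same_contrast_law.
by apply: filterS => v /(_ I) [].
Qed.

End same_observed_law.

Theorem theorem1 (R : realType)
    (dA : measure_display) (A : measurableType dA)
    (dX : measure_display) (X : measurableType dX)
    (M : unit_model R A X) (n p : nat)
    (f : {mfun A >-> 'rV[R]_n})
    (h : {mfun ('rV[R]_n * 'rV[R]_n)%type >-> 'rV[R]_p})
    (h_antisym : forall v v' : 'rV[R]_n, h (v, v') = - h (v', v))
    (M_fair : fair_assignment M) :
  (* tau_h(delta) = E[Y | h = delta] - E[Y | h = - delta], for elementary
     conditional expectations at atoms ... *)
  (forall delta : 'rV[R]_p,
     (0 < prob M (contrast_event M f h delta))%E ->
     (0 < prob M (contrast_event M f h (- delta)))%E /\
     cond_mean (prob M) (unit_effect M) (contrast_event M f h delta) =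
     cond_mean (prob M) (realized_outcome M) (contrast_event M f h delta)
     - cond_mean (prob M) (realized_outcome M)
         (contrast_event M f h (- delta))) /\
  (* ... and almost everywhere for all versions of the regression functions *)
  (forall tau m : 'rV[R]_p -> R,
     regression_function (prob M) (unit_effect M) (contrast M f h) tau ->
     regression_function (prob M) (realized_outcome M) (contrast M f h) m ->
     {ae contrast_law M f h, forall delta, tau delta = m delta - m (- delta)}) /\
  (* tau_h is a functional of the law of (Y, V, V^N, X) *)
  tau_h_identified M f h.
Proof.
split; [|split].
- move=> delta Pdelta; rewrite contrast_event_oppr//; split => //.
  exact: cond_mean_unit_effect.
- by move=> tau m; exact: regression_unit_effect.
move=> M' M'_fair same_law; split; last exact: same_regression_unit_effect.
move=> delta Pdelta; split.
  have := same_contrast_law M M' f h same_law _ (measurable_rV_set1 delta).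
  by rewrite /contrast_law /= /distribution /pushforward /= => ->.
by rewrite !cond_mean_unit_effect// !(same_cond_mean_realized_outcome M M').
Qed.
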